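(* Suppose that $A$ and $B$ are any pair of complementary sequences, with $n$th terms $a_n$ and $b_n$ respectively. Then: (1) The sequence of differences of $A$ and $B$, term by term, can always be decomposed in terms of the sum of two other sequences $C=(c_n)$ and $R=(r_n)$ as follows: $$b_n-a_n=c_n+r_n+1,$$ where $c_n$ counts the number of integers strictly between $a_n$ and $b_n$ that belong to the sequence $A$, and $r_n$ counts the number of integers strictly between $a_n$ and $b_n$ that belong to the sequence $B$. (2) If the two complementary sequences $A$ and $B$ are also Beatty sequences given by $\alpha$ and $\beta$ respectively, with $1<\alpha<2$, then $C$ and $R$ in (1) are Beatty sequences whose $n$th terms are given respectively by the slopes $\gamma=\frac{2-\alpha}{\alpha-1}$ and $\rho=2-\alpha$, that is, $c_n=[n\gamma]$ and $r_n=[n\rho]$. (3) There is a combinatorial interpretation of the formula in (1), that is, an algorithm, the Minimum Excluded with Skipping (MES) algorithm, that takes as input a sequence $C$ and outputs three sequences $A$, $B$ and $R$ such that if $a_n,b_n,c_n,r_n$ are the $n$th terms of $A,B,C,R$ respectively, then $$b_n-a_n=c_n+r_n+1.$$ Furthermore, the MES characterizes complementary sequences: $A$ and $B$ are complementary sequences if and only if there is a nonnegative sequence $C$ that generates $A$ and $B$ through the MES algorithm. (4) The MES generalizes the MEX algorithm as follows. Suppose there is an increasing sequence of positive integers $D$ such that $C=D\star\mathbb Z_{\{0\}}^{k-1}$ for some $k\in\mathbb N$. Then: (a) If $k=2$ and $D$ is the Beatty sequence defined by the golden ratio, then the MES algorithm (with skipping sequence $C$) and the MEX algorithm (with input $h_n=n$)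 coincide, i.e., they both produce $A$, where $A$ is the Beatty sequence of the golden ratio. In other words, the MES produces the sequence $A$ if and only if the skipping sequence $C$ can be defined as follows: any nonnegative integer $c$ appears once or twice in $C$, and $c$ appears twice in $C$ if and only if $c\in A$. (b) If $D$ is the Beatty sequence given by $\alpha$, where $$\alpha=\frac{k-1+\sqrt{k^2+1}}{k},$$ then the MES algorithm produces the Beatty sequence $D$ and its complement. In other words, the MES produces the sequence $D$ if and only if the skipping sequence $C$ can be defined as follows: any nonnegative integer $c$ appears $k$ or $k-1$ times in $C$, and $c$ appears $k$ times in $C$ if and only if $c\in D$. This coincides with the MEX and the golden ratio when $k=2$.
   Context: $\mathbb N$ denotes the natural numbers $1,2,3,\dots$ and $[x]$ the largest integer not exceeding $x$. $A$ and $B$ are complementary sets (sequences) of natural numbers if $A\cap B=\emptyset$ and $A\cup B=\mathbb N$. The elements of a set or multiset of integers bounded below are numbered, with multiplicity, in nondecreasing order. A Beatty sequence given by (with slope) $\beta>0$ is the sequence with $n$th term $[n\beta]$. The golden ratio is $\frac{1+\sqrt5}{2}$. For a set $S$ of integers and an integer $j\ge0$, $\operatorname{mex}_j(S)$ is the $(j+1)$-st smallest positive integer not in $S$, and $\operatorname{mex}(S)=\operatorname{mex}_0(S)$. Write $A_n=\{a_k:k\le n\}$, $B_n=\{b_k:k\le n\}$, $B_0=\emptyset$. MEX algorithm, with input a sequence $H=(h_n)$: $a_1=1$; $a_n=\operatorname{mex}(A_{n-1}\cup B_{n-1})$ for $n\ge2$; $b_n=a_n+h_n$ for $n\ge1$.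 With $h_n=n$ it produces the complementary Beatty pair of the golden ratio. MES algorithm, with input a sequence $C=(c_n)_{n\ge1}$ of nonnegative integers (the skipping sequence): $a_1=1$; $a_n=\operatorname{mex}(A_{n-1}\cup B_{n-1})$ for $n\ge2$; $b_n=\operatorname{mex}_{c_n}(A_n\cup B_{n-1})$ for $n\ge1$. The auxiliary sequence $R=(r_n)_{n\ge1}$ is defined by letting $r_n$ be the number of elements of $B_{n-1}$ in the (possibly empty) half-open integer interval $(a_n,b_{n-1}]$ (so $r_1=0$, since $B_0=\emptyset$). The sortjoin $X\star Y$ of two integer sequences is the union with repetition of their ordered elements. $X^j$ is the sortjoin of $j$ copies of $X$, and $\mathbb Z_{\{0\}}$ is the sequence of nonnegative integers $0,1,2,\dots$. Thus in $D\star\mathbb Z_{\{0\}}^{k-1}$ each nonnegative integer appears $k$ times if it lies in $D$ and $k-1$ times otherwise.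
   Formalization: In (1) the formula has |b_n-a_n|, signed if a_n<b_n. In (3) the formula assumes B increasing, and the characterization reads: A, B complementary with all a_n<b_n iff B is increasing and some C generates A, B. The ''if and only if'' in (4) is for C nondecreasing or B increasing. *)

(* Defs.v *)
From HB Require Import structures.
From mathcomp Require Import all_boot all_order all_algebra.
From mathcomp Require Import all_classical all_reals.

Set Implicit Arguments.
Unset Strict Implicit.
Unset Printing Implicit Defensive.
Import Order.TTheory GRing.Theory Num.Theory.
Local Open Scope classical_set_scope.

(* Sequences are indexed by the positive integers: a sequence is a function    *)
(* on nat whose value at index 0 is irrelevant.                                *)

Definition elements (s : nat -> nat) : set nat := s @` [set n | 0 < n].

(* The numbering [:: s_1; ...; s_n] of the set S_n = {s_k : 1 <= k <= n}.      *)
Definition terms (s : nat -> nat) (n : nat) : seq nat :=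
  [seq s k | k <- iota 1 n].

Definition seq_increasing (s : nat -> nat) : Prop :=
  forall m n, 0 < m -> m < n -> s m < s n.

Definition seq_nondecreasing (s : nat -> nat) : Prop :=
  forall m n, 0 < m -> m <= n -> s m <= s n.

Definition complementary (A B : set nat) : Prop :=
  A `&` B = set0 /\ A `|` B = [set n | 0 < n].

(* The elements of each of the two sets are numbered in increasing order.      *)
Definition complementary_seqs (a b : nat -> nat) : Prop :=
  [/\ seq_increasing a, seq_increasing b & complementary (elements a) (elements b)].

(* The number of integers strictly between x and y that belong to A, whichever *)
(* of x and y is the larger.                                                   *)
Definition between (A : set nat) (x y : nat) : nat :=
  count (fun m => `[< A m >]) (index_iota (minn x y).+1 (maxn x y)).

Definition countC (a b : nat -> nat) (n : nat) : nat :=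
  between (elements a) (a n) (b n).

Definition countR (a b : nat -> nat) (n : nat) : nat :=
  between (elements b) (a n) (b n).

Definition is_beatty (R : realType) (beta : R) (s : nat -> nat) : Prop :=
  (0 < beta)%R /\
  forall n, 0 < n -> (s n)%:Z%R = Num.floor (n%:R * beta)%R.

Definition golden (R : realType) : R := ((1 + Num.sqrt 5) / 2)%R.

Definition alpha (R : realType) (k : nat) : R :=
  ((k%:R - 1 + Num.sqrt (k%:R ^+ 2 + 1)) / k%:R)%R.

(* The (j+1)-st smallest positive integer outside the finite set S; at least   *)
(* j+1 of the integers 1, ..., |S|+j+1 lie outside S.                          *)
Definition mex (j : nat) (S : seq nat) : nat :=
  nth 0 [seq m <- iota 1 (size S + j).+1 | m \notin S] j.

Definition MEX (h a b : nat -> nat) : Prop :=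
  [/\ a 1 = 1,
      forall n, 2 <= n -> a n = mex 0 (terms a n.-1 ++ terms b n.-1)
    & forall n, 1 <= n -> b n = a n + h n].

(* [MES c a b r]: with skipping sequence c, the algorithm outputs the          *)
(* sequences a and b, and r is the auxiliary sequence.                         *)
Definition MES (c a b r : nat -> nat) : Prop :=
  [/\ a 1 = 1,
      forall n, 2 <= n -> a n = mex 0 (terms a n.-1 ++ terms b n.-1),
      forall n, 1 <= n -> b n = mex (c n) (terms a n ++ terms b n.-1)
    & forall n, 1 <= n ->
        r n = count (fun m => m \in terms b n.-1)
                    (index_iota (a n).+1 (b n.-1).+1)].

Definition appears (s : nat -> nat) (v m : nat) : Prop :=
  ([set n | 0 < n /\ s n = v] #= `I_m)%card.

(* A multiset of nonnegative integers is its multiplicity function. Unlike     *)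
(* sequences nat -> nat, multisets may be finite, as is the zeroth power       *)
(* [sortpow X 0].                                                              *)
Definition multiset := nat -> nat.

Definition sortjoin (X Y : multiset) : multiset := fun v => X v + Y v.

Definition sortpow (X : multiset) (j : nat) : multiset :=
  iter j (sortjoin X) (fun=> 0).

Definition set_multiset (A : set nat) : multiset :=
  fun v => nat_of_bool `[< A v >].

Definition nonneg_ints : multiset := set_multiset [set: nat].

(* s lists the elements of X, with multiplicity, in nondecreasing order.       *)
Definition numbering (s : nat -> nat) (X : multiset) : Prop :=
  seq_nondecreasing s /\ forall v, appears s v (X v).

(* The skipping sequence D * Z_{0}^{k-1}.                                      *)
Definition skipping (k : nat) (d : nat -> nat) : multiset :=
  sortjoin (set_multiset (elements d)) (sortpow nonneg_ints k.-1).

Definition skipping_rule (k : nat) (A : set nat) (c : nat -> nat) : Prop :=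
  seq_nondecreasing c /\
  forall v, (appears c v k \/ appears c v k.-1) /\ (appears c v k <-> A v).

(* Main.v *)
(* Counting the elements of A and of B below b_n and up to a_n shows that, for
   complementary sequences with a_n < b_n, there are b_n - 2n elements of A and
   2n - 1 - a_n elements of B strictly between a_n and b_n. For Beatty sequences
   complementarity forces 1/alpha + 1/beta = 1 by density and makes alpha
   irrational, which turns these counts into [n gamma] and [n rho]. The MES
   algorithm run on the first of these counts rebuilds A and B, and since a_n is
   a mex every run of MES covers all positive integers.

   For (4), alpha satisfies k alpha^2 = 2(k-1) alpha + 2, equivalently
   1/gamma = k - 1 + 1/alpha. Hence n gamma < v iff n - v(k-1) < v/alpha, so the
   value v is taken k - 1 times by [n gamma], plus once more when v is in D: the
   skipping sequence of D is [n gamma], and Rayleigh's theorem provides the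
   complement of D to which (2) and (3) apply. *)
Require Import Defs.
From HB Require Import structures.
From mathcomp Require Import all_boot all_order all_algebra.
From mathcomp Require Import all_classical all_reals.
From mathcomp Require Import zify ring lra.

Set Implicit Arguments.
Unset Strict Implicit.
Unset Printing Implicit Defensive.
Import Order.TTheory GRing.Theory Num.Theory.

(** * Counting functions on the positive integers *)

Definition upto (P : pred nat) (N : nat) : nat := count P (iota 1 N).

Lemma uptoS P N : upto P N.+1 = upto P N + P N.+1.
Proof. by rewrite /upto -[N.+1]addn1 iotaD count_cat /= addn0 add1n addn1. Qed.

Lemma upto_le P M N : M <= N -> upto P M <= upto P N.
Proof. by move=> /subnKC <-; rewrite /upto iotaD count_cat leq_addr. Qed.

Lemma upto_lt (P : pred nat) M N : M < N -> P N -> upto P M < upto P N.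
Proof.
case: N => // N MN PN; rewrite uptoS PN addn1 ltnS; exact: upto_le.
Qed.

Lemma upto_sub (P Q : pred nat) N :
  (forall m, P m -> Q m) -> upto P N <= upto Q N.
Proof. by move=> PQ; apply: sub_count. Qed.

Lemma upto_predC P N : upto P N + upto (predC P) N = N.
Proof. by rewrite /upto count_predC size_iota. Qed.

Lemma eq_upto (P Q : pred nat) N :
  (forall m, 0 < m <= N -> P m = Q m) -> upto P N = upto Q N.
Proof.
move=> PQ; apply: eq_in_count => m; rewrite mem_iota add1n ltnS; exact: PQ.
Qed.

Lemma upto_index_iota P x y :
  x < y -> upto P x + count P (index_iota x.+1 y) = upto P y.-1.
Proof.
case: y => // y; rewrite ltnS /= => xy.
by rewrite /upto /index_iota subSS -count_cat -{2}(subnKC xy) iotaD add1n.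
Qed.

(** * Minimum excluded values *)

Lemma upto_mem_size (S : seq nat) N : upto (fun m => m \in S) N <= size S.
Proof.
rewrite /upto -size_filter; apply: uniq_leq_size.
  by rewrite filter_uniq ?iota_uniq.
by move=> m; rewrite mem_filter => /andP[].
Qed.

(** Of the integers below [m], exactly [j] avoid [S] and at most [size S] lie in it, so [m] is
    within the finite range that [mex] filters and sits at position [j] of the filtered list. *)
Lemma mex_eq j (S : seq nat) m : 0 < m -> m \notin S ->
  upto (fun i => i \notin S) m.-1 = j -> mex j S = m.
Proof.
case: m => // m _ mS /= Ej.
have mle : m <= size S + j.
  rewrite -[m](upto_predC (fun i => i \in S)) -Ej.
  by rewrite leq_add2r upto_mem_size.
rewrite /mex -(subnKC mle) -addnS iotaD filter_cat nth_cat size_filter.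
by rewrite -/(upto _ _) Ej ltnn subnn /= add1n mS.
Qed.

(** Take the least [N] with more than [j] integers outside [S] up to [N]: minimality forces [N]
    itself outside [S] and exactly [j] such integers below it, so [mex_eq] applies. *)
Lemma mexP j (S : seq nat) :
  [/\ 0 < mex j S, mex j S \notin S
    & upto (fun i => i \notin S) (mex j S).-1 = j].
Proof.
have ex : exists N, j < upto (fun i => i \notin S) N.
  exists (size S + j).+1; have := upto_mem_size S (size S + j).+1.
  have : _ + upto (fun i => i \notin S) _ = _ :=
    upto_predC (fun i => i \in S) (size S + j).+1.
  lia.
case: (ex_minnP ex) => -[//|m] jm min_m.
have mj : upto (fun i => i \notin S) m <= j.
  by rewrite leqNgt; apply/negP => /min_m; rewrite ltnn.
move: jm; rewrite uptoS; case: (boolP (m.+1 \in S)) => /= mS jm.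
  by rewrite addn0 ltnNge mj in jm.
have mE : upto (fun i => i \notin S) m.+1.-1 = j.
  by rewrite addn1 ltnS in jm; apply/eqP; rewrite eqn_leq mj.
by rewrite (mex_eq (ltn0Sn m) mS mE); split.
Qed.

Lemma mex0_mem (S : seq nat) m : 0 < m < mex 0 S -> m \in S.
Proof.
case: (mexP 0 S) => _ _ + /andP[m0 mlt]; apply: contra_eqT => mS.
rewrite -lt0n; apply: leq_trans (upto_le _ (_ : m <= _)); last by lia.
by case: m m0 mS {mlt} => // m _ mS; rewrite uptoS mS addn1.
Qed.

(** Otherwise the [j + 1] integers outside [T] up to [mex j T] would also avoid [S] and lie below
    [mex i S], where there are only [i] such integers. *)
Lemma mex_le i j (S T : seq nat) :
  i <= j -> {subset S <= T} -> mex i S <= mex j T.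
Proof.
move=> ij ST; case: (mexP i S) (mexP j T) => i0 iS iE [j0 jT jE].
rewrite leqNgt; apply/negP => lt.
have jS : mex j T \notin S by apply: contra jT => /ST.
suff : j < i by lia.
rewrite -[X in X < _]jE -[X in _ < X]iE.
apply: leq_ltn_trans (upto_sub (Q := fun m => m \notin S) _ _) _.
  by move=> m; apply: contra => /ST.
apply: leq_trans (upto_lt (P := fun m => m \notin S) (N := mex j T) _ jS) _.
  by lia.
by apply: upto_le; lia.
Qed.

(** * Terms, elements and ranks of increasing sequences *)

Lemma terms0 s : terms s 0 = [::].
Proof. by []. Qed.

Lemma termsS s n : terms s n.+1 = rcons (terms s n) (s n.+1).
Proof. by rewrite /terms -[n.+1]addn1 iotaD map_cat cats1 add1n addn1. Qed.

Lemma size_terms s n : size (terms s n) = n.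
Proof. by rewrite size_map size_iota. Qed.

Lemma mem_termsP (s : nat -> nat) n m :
  reflect (exists2 k, 0 < k <= n & s k = m) (m \in terms s n).
Proof.
apply: (iffP mapP) => -[k]; first by rewrite mem_iota => ? ->; exists k; lia.
by move=> ? <-; exists k; rewrite // mem_iota; lia.
Qed.

Lemma terms_subset s m n : m <= n -> {subset terms s m <= terms s n}.
Proof.
by move=> mn x /mem_termsP[k k_le <-]; apply/mem_termsP; exists k => //; lia.
Qed.

Lemma elements_term (s : nat -> nat) k : 0 < k -> elements s (s k).
Proof. by exists k. Qed.

Lemma elementsP s m :
  reflect (exists2 k, 0 < k & s k = m) `[< elements s m >].
Proof. exact: (iffP (asboolP _)). Qed.

Lemma increasing_leq s : seq_increasing s ->
  forall m n, 0 < m -> 0 < n -> (s m <= s n) = (m <= n).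
Proof.
move=> inc m n m0 n0; case: (ltngtP m n) => [/(inc _ _ m0)|/(inc _ _ n0)|->]; lia.
Qed.

Lemma increasing_inj s : seq_increasing s ->
  forall m n, 0 < m -> 0 < n -> s m = s n -> m = n.
Proof.
move=> inc m n m0 n0 E; apply/eqP; rewrite eqn_leq.
by rewrite -(increasing_leq inc m0 n0) -(increasing_leq inc n0 m0) E leqnn.
Qed.

Lemma increasing_step s :
  (forall n, 0 < n -> s n < s n.+1) -> seq_increasing s.
Proof.
move=> step m n m0; elim: n => // n IH; rewrite ltnS leq_eqVlt.
case/predU1P => [<-|mn]; first exact: step.
by apply: ltn_trans (IH mn) (step _ _); lia.
Qed.

Lemma increasing_ge s : seq_increasing s -> (forall n, 0 < n -> 0 < s n) ->
  forall n, n <= s n.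
Proof.
move=> inc pos; elim=> // -[|n] IH; first exact: pos.
by apply: leq_ltn_trans IH _; apply: inc.
Qed.

Section Rank.
Variable s : nat -> nat.
Hypotheses (inc : seq_increasing s) (pos : forall n, 0 < n -> 0 < s n).

Definition rank (N : nat) : nat := upto (fun m => `[< elements s m >]) N.

(** A Galois connection between [rank] and [s]. Each direction compares the cardinalities of
    duplicate-free lists: either the first [k] terms are all at most [N], or every element up to [N]
    is among the first [k - 1] terms. *)
Lemma rank_ge k N : 0 < k -> (k <= rank N) = (s k <= N).
Proof.
move=> k0; have term_uniq n : uniq (terms s n).
  rewrite map_inj_in_uniq ?iota_uniq // => x y; rewrite !mem_iota => x0 y0.
  by apply: (increasing_inj inc); lia.
rewrite /rank /upto -size_filter; case: (leqP (s k) N) => skN.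
  rewrite -[k in k <= _](size_terms s); apply: uniq_leq_size => // m.
  case/mem_termsP => i ik <-; rewrite mem_filter mem_iota.
  have := increasing_leq inc (m := i) (n := k); have := @pos i.
  rewrite andbC => ? ?; apply/andP; split; first by lia.
  by apply/asboolP/elements_term; lia.
apply/negbTE; rewrite -ltnNge -[k in _ < k](prednK k0) ltnS.
rewrite -[X in _ <= X](size_terms s); apply: uniq_leq_size => [|m].
  by rewrite filter_uniq ?iota_uniq.
rewrite mem_filter mem_iota => /andP[/elementsP[i i0 <-] ?].
apply/mem_termsP; exists i => //.
by have := increasing_leq inc k0 i0; lia.
Qed.

Lemma rank_term n : 0 < n -> rank (s n) = n.
Proof.
move=> n0; apply/eqP; rewrite eqn_leq rank_ge // leqnn andbT leqNgt.
by rewrite rank_ge // (increasing_leq inc) // ltnn.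
Qed.

Lemma rank_predterm n : 0 < n -> rank (s n).-1 = n.-1.
Proof.
move=> n0; have sn := pos n0; apply/eqP; rewrite eqn_leq; apply/andP; split.
  by rewrite -ltnS prednK // ltnNge rank_ge //; lia.
case: n n0 sn => // -[//|n] _ sn /=; rewrite rank_ge //.
by have := @inc n.+1 n.+2; lia.
Qed.

End Rank.

(** * Complementary sequences and their counts *)

Section Complementary.
Variables a b : nat -> nat.
Hypothesis comp : complementary_seqs a b.

Let a_inc : seq_increasing a. Proof. by case: comp. Qed.
Let b_inc : seq_increasing b. Proof. by case: comp. Qed.

Lemma compl_mem m :
  (exists2 k, 0 < k & a k = m) \/ (exists2 k, 0 < k & b k = m) <-> 0 < m.
Proof.
case: comp => _ _ [_ E].
by rewrite -[_ \/ _]/((elements a `|` elements b)%classic m) E.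
Qed.

Lemma compl_disjoint m : elements a m -> elements b m -> False.
Proof.
case: comp => _ _ [E _] am bm.
by have : (elements a `&` elements b)%classic m by []; rewrite E.
Qed.

Lemma compl_pos : (forall n, 0 < n -> 0 < a n) /\ (forall n, 0 < n -> 0 < b n).
Proof.
by split=> n n0; apply/compl_mem; [left|right]; exists n.
Qed.

Let a_pos : forall n, 0 < n -> 0 < a n. Proof. by case: compl_pos. Qed.
Let b_pos : forall n, 0 < n -> 0 < b n. Proof. by case: compl_pos. Qed.

Lemma compl_neq m n : 0 < m -> 0 < n -> a m <> b n.
Proof.
by move=> m0 n0 E; apply: (@compl_disjoint (a m)); [exists m|rewrite E; exists n].
Qed.

Lemma compl_elements m :
  0 < m -> `[< elements b m >] = ~~ `[< elements a m >].
Proof.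
move=> m0; apply/idP/idP => [/asboolP bm|].
  by apply/asboolP => am; apply: compl_disjoint bm.
by move/asboolPn => am; apply/asboolP; case/compl_mem: m0.
Qed.

Lemma compl_rank N : rank a N + rank b N = N.
Proof.
rewrite -[RHS](upto_predC (fun m => `[< elements a m >])); congr addn.
by apply: eq_upto => m /andP[m0 _]; rewrite compl_elements.
Qed.

Lemma between_compl x y : x != y ->
  between (elements a) x y + between (elements b) x y + 1 = maxn x y - minn x y.
Proof.
move=> xy; rewrite /between.
rewrite -[X in _ + X + 1](@eq_in_count _ (predC (fun m => `[< elements a m >]))).
  rewrite count_predC size_iota; lia.
by move=> m; rewrite mem_index_iota => m_gt; rewrite [RHS]compl_elements //; lia.
Qed.

Lemma countCR n : 0 < n ->
  `|(b n)%:Z - (a n)%:Z|%R = (countC a b n + countR a b n + 1)%:Z%R.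
Proof.
move=> n0; rewrite between_compl; last by apply/eqP/compl_neq.
by lia.
Qed.

Section Term.
Variable n : nat.
Hypotheses (n_gt0 : 0 < n) (ab : a n < b n).

(** Of the [b n - 1] positive integers below [b n], [n - 1] lie in B and the others in A; the first
    [n] of the latter go up to [a n]. *)
Lemma countC_term : countC a b n + n.*2 = b n.
Proof.
rewrite /countC /between (minn_idPl (ltnW ab)) (maxn_idPr (ltnW ab)).
have := upto_index_iota (fun m => `[< elements a m >]) ab.
rewrite -!/(rank a _) rank_term //.
have := compl_rank (b n).-1; rewrite (rank_predterm b_inc b_pos n_gt0).
lia.
Qed.

Lemma countR_term : countR a b n + a n + 1 = n.*2.
Proof.
have := between_compl (negbT (ltn_eqF ab)).
rewrite -/(countC a b n) -/(countR a b n).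
have := countC_term; have := increasing_ge b_inc b_pos n; lia.
Qed.

Lemma compl_mem_prefix m : 0 < m < b n ->
  (m \in terms a n ++ terms b n.-1) = ~~ ((a n < m) && `[< elements a m >]).
Proof.
move=> /andP[m0 mb]; rewrite mem_cat; case: (boolP `[< elements a m >]) => am.
  rewrite andbT -leqNgt; have -> : m \in terms b n.-1 = false.
    apply/negbTE/mem_termsP => -[k k0 km]; move/asboolP: am => am.
    by apply: (compl_disjoint am); rewrite -km; apply: elements_term; lia.
  rewrite orbF; apply/mem_termsP/idP => [[k k0 <-]|].
    by rewrite (increasing_leq a_inc) //; lia.
  case/elementsP: am => k k0 <-; rewrite (increasing_leq a_inc) // => kn.
  by exists k => //; lia.
rewrite andbF /=; apply/orP; right.
move: am; rewrite -compl_elements // => /elementsP[k k0 km].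
apply/mem_termsP; exists k => //; move: mb; rewrite -km ltnNge.
by rewrite (increasing_leq b_inc) //; lia.
Qed.

Lemma countC_skipped :
  upto (fun m => m \notin terms a n ++ terms b n.-1) (b n).-1 = countC a b n.
Proof.
rewrite -(upto_index_iota _ ab) /countC /between.
rewrite (minn_idPl (ltnW ab)) (maxn_idPr (ltnW ab)).
rewrite (@eq_upto _ pred0) => [|m /andP[m0 ma]].
  rewrite [upto pred0 _]count_pred0; apply: eq_in_count => m.
  rewrite mem_index_iota => /andP[am mb].
  by rewrite compl_mem_prefix ?am ?negbK //; lia.
by rewrite compl_mem_prefix ?[a n < m]ltnNge ?ma //; lia.
Qed.

Lemma compl_mex_b : mex (countC a b n) (terms a n ++ terms b n.-1) = b n.
Proof.
apply: (mex_eq (b_pos n_gt0)) countC_skipped.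
rewrite mem_cat negb_or; apply/andP; split; apply/mem_termsP => -[k k0].
  by apply: compl_neq; lia.
by move/(increasing_inj b_inc); lia.
Qed.

(** The algorithm counts on the interval from [a n] to [b n.-1], and [countR] up to [b n]; no
    element of B lies strictly between [b n.-1] and [b n]. *)
Lemma countR_aux :
  count (fun m => m \in terms b n.-1) (index_iota (a n).+1 (b n.-1).+1)
  = countR a b n.
Proof.
have -> : countR a b n =
    count (fun m => m \in terms b n.-1) (index_iota (a n).+1 (b n)).
  rewrite /countR /between (minn_idPl (ltnW ab)) (maxn_idPr (ltnW ab)).
  apply: eq_in_count => m; rewrite mem_index_iota => /andP[am mb].
  apply/elementsP/mem_termsP => -[k k0 km]; exists k => //; last by lia.
  by move: mb; rewrite -km ltnNge (increasing_leq b_inc) //; lia.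
(* For [n = 1] the bound [b 0] is meaningless, but the list of earlier terms is empty and both
   counts vanish. *)
case: (posnP n.-1) => [->|n1]; first by rewrite terms0 !count_pred0.
have bn1 : b n.-1 < b n by apply: b_inc; lia.
have big m : b n.-1 < m -> m \in terms b n.-1 = false.
  move=> lt; apply/negbTE/mem_termsP => -[k k0 km].
  by move: lt; rewrite -km ltnNge (increasing_leq b_inc) //; lia.
case: (leqP (b n.-1) (a n)) => ba.
  rewrite /index_iota subSS (eqP ba) /=; apply/esym/eqP.
  rewrite -leqn0 leqNgt -has_count; apply/hasPn => m.
  by rewrite mem_index_iota => m_gt; rewrite big //; lia.
rewrite /index_iota -[b n - _](subnKC (_ : (b n.-1).+1 - (a n).+1 <= _));
  last by lia.
rewrite iotaD count_cat -[LHS]addn0; congr addn; apply/esym/eqP.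
rewrite -leqn0 leqNgt -has_count; apply/hasPn => m.
by rewrite mem_iota => m_gt; rewrite big //; lia.
Qed.

End Term.

Lemma compl_mex_a n : (forall m, 0 < m -> a m < b m) -> 0 < n ->
  mex 0 (terms a n.-1 ++ terms b n.-1) = a n.
Proof.
move=> ab n0; apply: mex_eq; first exact: a_pos.
  rewrite mem_cat negb_or; apply/andP; split; apply/mem_termsP => -[k k0 E].
    by move/(increasing_inj a_inc): E; lia.
  by move/esym/compl_neq: E; lia.
(* Every positive [m < a n] is already used: if [m] is [a k] then [k < n], and if it is [b k] then
   [a k < b k < a n] again gives [k < n]. *)
rewrite (@eq_upto _ pred0) => [|m m_an]; first exact: count_pred0.
rewrite mem_cat; apply/negbTE; rewrite negbK; apply/orP.
have /compl_mem[[k k0 km]|[k k0 km]] : 0 < m by lia.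
  left; apply/mem_termsP; exists k => //.
  have : a k < a n by lia.
  by rewrite ltnNge (increasing_leq a_inc) //; lia.
right; apply/mem_termsP; exists k => //.
have : a k < a n by have := ab k k0; lia.
by rewrite ltnNge (increasing_leq a_inc) //; lia.
Qed.

Lemma compl_MES : (forall n, 0 < n -> a n < b n) ->
  MES (countC a b) a b (countR a b).
Proof.
move=> ab; split=> [|n n2|n n1|n n1].
- by rewrite -(compl_mex_a ab (ltn0Sn 0)).
- by rewrite compl_mex_a //; lia.
- by rewrite compl_mex_b ?ab.
- by rewrite countR_aux ?ab.
Qed.

End Complementary.

(** * Runs of the MES algorithm *)

Section MESTheory.
Variables c a b r : nat -> nat.
Hypothesis mes : MES c a b r.

(** The recursion extends to [n = 1] because the mex of the empty set is 1. *)
Lemma MES_a n : 0 < n -> a n = mex 0 (terms a n.-1 ++ terms b n.-1).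
Proof.
case: mes => a1 aE _ _; rewrite leq_eqVlt => /predU1P[<-|]; last exact: aE.
by rewrite a1.
Qed.

Lemma MES_b n : 0 < n -> b n = mex (c n) (terms a n ++ terms b n.-1).
Proof. by case: mes => _ _ + _; apply. Qed.

(** The excluded set grows, so its mex cannot decrease, and [a n] is itself excluded at the next
    stage. *)
Lemma MES_a_increasing : seq_increasing a.
Proof.
apply: increasing_step => n n0; rewrite (ltn_neqAle (a n)); apply/andP; split.
  rewrite (@MES_a n.+1) //; have [_ + _] := mexP 0 (terms a n ++ terms b n).
  apply: contraNneq => <-; rewrite mem_cat; apply/orP; left.
  by apply/mem_termsP; exists n; rewrite // n0 leqnn.
rewrite (MES_a n0) (@MES_a n.+1) //; apply: mex_le => // m /=.
rewrite !mem_cat => /orP[] /(@terms_subset _ n.-1 n (leq_pred n)) -> //.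
by rewrite orbT.
Qed.

Lemma MES_pos : (forall n, 0 < n -> 0 < a n) /\ (forall n, 0 < n -> 0 < b n).
Proof.
split=> n n0.
  by rewrite MES_a //; case: (mexP 0 (terms a n.-1 ++ terms b n.-1)).
by rewrite MES_b //; case: (mexP (c n) (terms a n ++ terms b n.-1)).
Qed.

Lemma MES_below n m : 0 < n -> 0 < m < a n ->
  m \in terms a n.-1 ++ terms b n.-1.
Proof. by move=> n0; rewrite (MES_a n0); apply: mex0_mem. Qed.

Lemma MES_b_notin n : 0 < n -> b n \notin terms a n ++ terms b n.-1.
Proof. by move=> /MES_b ->; case: (mexP (c n) (terms a n ++ terms b n.-1)). Qed.

(** If [a i] and [b j] had the same value, the one chosen later would have excluded it; [a i] is
    chosen first exactly when [i <= j]. *)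
Lemma MES_complementary : complementary (elements a) (elements b).
Proof.
have [a_pos b_pos] := MES_pos; split; apply/seteqP; split=> m //=.
- case=> -[i] /= i0 <- [j] /= j0 ji; case: (leqP i j) => ij.
    have := MES_b_notin j0; rewrite ji mem_cat => /norP[/mem_termsP[]].
    by exists i => //; lia.
  have [_ + _] := mexP 0 (terms a i.-1 ++ terms b i.-1).
  rewrite -MES_a // mem_cat => /norP[_ /mem_termsP[]].
  by exists j => //; lia.
- by case=> -[n /= n0 <-]; [exact: a_pos|exact: b_pos].
(* Coverage: [a m.+1] is at least [m + 1], so [m] has been used before that mex is taken. *)
- move=> m0; have : m \in terms a m ++ terms b m.
    apply: (@MES_below m.+1) => //; rewrite m0.
    exact: increasing_ge MES_a_increasing a_pos m.+1.
  by rewrite mem_cat => /orP[] /mem_termsP[k /andP[k0 _] km];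
    [left|right]; exists k.
Qed.

(** The value [b n] is new, whereas [a n] and all positive integers below it have been used. *)
Lemma MES_ltn n : 0 < n -> a n < b n.
Proof.
move=> n0; rewrite ltnNge; apply/negP; rewrite leq_eqVlt.
have := MES_b_notin n0; rewrite mem_cat => /norP[bna bnb].
case/predU1P => [E|lt]; first by case/mem_termsP: bna; exists n; rewrite ?n0 ?leqnn.
have [_ b_pos] := MES_pos.
have := @MES_below n (b n) n0; rewrite b_pos // lt => /(_ isT).
rewrite mem_cat (negbTE bnb) orbF => /(terms_subset (leq_pred n)).
exact/negP.
Qed.

(** By [mex_le], enlarging both the number skipped and the excluded set cannot lower the mex, and
    [b n] is excluded at stage [n + 1]. *)
Lemma MES_b_increasing : seq_nondecreasing c -> seq_increasing b.
Proof.
move=> c_nd; apply: increasing_step => n n0.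
rewrite (ltn_neqAle (b n)); apply/andP; split.
  apply: contraNneq (@MES_b_notin n.+1 isT) => <-.
  rewrite mem_cat; apply/orP; right.
  by apply/mem_termsP; exists n; rewrite // n0 /=.
rewrite (MES_b n0) (@MES_b n.+1) //; apply: mex_le => [|m]; first exact: c_nd.
rewrite !mem_cat.
move=> /orP[/(terms_subset (leqnSn n))|/(terms_subset (leq_pred n))] -> //.
by rewrite orbT.
Qed.

Section Increasing.
Hypothesis b_inc : seq_increasing b.

Lemma MES_complementary_seqs : complementary_seqs a b.
Proof.
split=> //; [exact: MES_a_increasing|exact: MES_complementary].
Qed.

Lemma MES_countC n : 0 < n -> c n = countC a b n.
Proof.
move=> n0; rewrite -(countC_skipped MES_complementary_seqs n0 (MES_ltn n0)).
rewrite [in RHS]MES_b //.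
by have [_ _ ->] := mexP (c n) (terms a n ++ terms b n.-1).
Qed.

Lemma MES_countR n : 0 < n -> r n = countR a b n.
Proof.
move=> n0; rewrite -(countR_aux MES_complementary_seqs n0 (MES_ltn n0)).
by case: mes => _ _ _; apply.
Qed.

End Increasing.
End MESTheory.

Lemma MES_unique c a b r a' b' r' : MES c a b r -> MES c a' b' r' ->
  forall n, 0 < n -> [/\ a' n = a n, b' n = b n & r' n = r n].
Proof.
move=> mes mes'.
have step n : terms a' n.-1 = terms a n.-1 -> terms b' n.-1 = terms b n.-1 ->
    0 < n -> a' n = a n /\ b' n = b n.
  case: n => //= n ea eb _.
  have an : a' n.+1 = a n.+1 by rewrite (MES_a mes) // (MES_a mes') //= ea eb.
  by rewrite an (MES_b mes) // (MES_b mes') // !termsS ea eb an.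
have E n : terms a' n = terms a n /\ terms b' n = terms b n.
  elim: n => // n [ea eb]; have [an bn] := step n.+1 ea eb isT.
  by rewrite !termsS ea eb an bn.
have ab n : 0 < n -> a' n = a n /\ b' n = b n.
  by move=> n0; have [ea eb] := E n.-1; apply: step.
move=> n n0; have [an bn] := ab n n0; split=> //.
case: (mes) (mes') => _ _ _ rE [_ _ _ rE']; rewrite rE // rE' // an.
(* At [n = 1] the two runs may disagree on [b 0], but the lists of earlier terms are empty, so both
   counts are 0. *)
have [_ ->] := E n.-1; case: (posnP n.-1) => [->|n1].
  by rewrite terms0 !count_pred0.
by have [_ ->] := ab _ n1.
Qed.

Lemma MES_exists c : exists a b r, MES c a b r.
Proof.
(* The state after [n] rounds is the pair of lists of the first [n] terms, which turns a recursion
   on all earlier terms into plain iteration. Rounds are numbered from 0, hence [c n.+1]. *)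
pose step n (S : seq nat * seq nat) :=
  let A := rcons S.1 (mex 0 (S.1 ++ S.2)) in
  (A, rcons S.2 (mex (c n.+1) (A ++ S.2))).
pose st n := iteri n step ([::], [::]).
pose a n := last 0 (st n).1; pose b n := last 0 (st n).2.
have E n : terms a n = (st n).1 /\ terms b n = (st n).2.
  by elim: n => // n [ea eb]; rewrite !termsS ea eb /a /b /= !last_rcons.
exists a, b, (fun n => count (fun m => m \in terms b n.-1)
                    (index_iota (a n).+1 (b n.-1).+1)).
split=> // n n0.
  by case: n n0 => // n _; have [-> ->] := E n; rewrite /a /= last_rcons.
case: n n0 => // n _; have [-> _] := E n.+1; have [_ ->] := E n.
by rewrite /b /= last_rcons.
Qed.

(** * Numberings of multisets *)

Section NumberingTheory.
Local Open Scope classical_set_scope.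

(** This turns the cardinality in [appears] into an explicit block of indices. The set is bounded by
    its least missing integer, which exists because the set is finite and which must be [m] by
    cardinality. *)
Lemma card_initial_segment (F : set nat) (m : nat) :
  (forall i j, i <= j -> F j -> F i) -> (F #= `I_m)%card -> F = `I_m.
Proof.
move=> down cF.
have [FT|nFT] := pselect (forall i, F i).
  have FE : F = setT by apply/seteqP; split.
  have := @infinite_nat; rewrite -FE => nfin; case: nfin.
  by exists m.
have ex : exists i, ~~ `[< F i >].
  apply: contrapT => nex; apply: nFT => i; apply: contrapT => nFi.
  by apply: nex; exists i; apply/asboolPn.
case: (ex_minnP ex) => i /asboolPn nFi min_i.
have FE : F = `I_i.
  apply/seteqP; split=> j /=.
    by move=> Fj; rewrite ltnNge; apply/negP => /down /(_ Fj).
  move=> ji; apply: contrapT => /asboolPn/min_i; lia.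
by move: cF; rewrite FE => /card_eq_II ->.
Qed.

Lemma card_interval (p m : nat) : ([set n | p < n <= p + m] #= `I_m)%card.
Proof.
apply/card_esym; apply/card_set_bijP; exists (fun i => p.+1 + i); split.
- by move=> i /=; lia.
- by move=> i j _ _ /addnI.
- by move=> n /= pn; exists (n - p.+1) => /=; lia.
Qed.

(** Cumulative multiplicities determine a nondecreasing listing: by induction on [v], the value [v]
    fills the block of [X v] indices that follows those of the smaller values. *)
Lemma numbering_lt s (X : multiset) : numbering s X ->
  forall n v, 0 < n -> (s n < v) = (n <= \sum_(u < v) X u).
Proof.
move=> [s_nd sX] n v; elim: v n => [|v IH] n n0.
  by rewrite big_ord0 ltn0 leqNgt n0.
rewrite big_ord_recr /=; set p := \sum_(u < v) X u.
(* Past index [p] all values are at least [v], so after a shift by [p + 1] the indices of the value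
   [v] form an initial segment. *)
have E : [set i | 0 < p.+1 + i /\ s (p.+1 + i) = v] = `I_(X v).
  apply: card_initial_segment => [i j ij /= [_ sj]|].
    split=> //; apply/eqP; rewrite eqn_leq -{1}sj s_nd ?leq_add2l //=.
    by rewrite leqNgt IH //; rewrite -/p; lia.
  apply: card_eq_trans (sX v).
  apply/card_set_bijP; exists (fun i => p.+1 + i).
  split=> [i /=|i j _ _ /addnI|m /=] //.
  move=> [m0 sm]; exists (m - p.+1) => /=; last first.
    suff : p < m by lia.
    by rewrite ltnNge -IH // sm ltnn.
  suff pm : p < m by rewrite subnKC.
  by rewrite ltnNge -IH // sm ltnn.
rewrite ltnS leq_eqVlt IH // -/p; case: (leqP n p) => np.
  by rewrite orbT; apply/esym; lia.
rewrite orbF; apply/eqP/idP => [sn|].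
  have : [set i | 0 < p.+1 + i /\ s (p.+1 + i) = v] (n - p.+1) by rewrite /= subnKC.
  by rewrite E /=; lia.
move=> n_le; have : `I_(X v) (n - p.+1) by move=> /=; lia.
by rewrite -E /= subnKC // => -[].
Qed.

Lemma numbering_unique s t (X : multiset) : numbering s X -> numbering t X ->
  forall n, 0 < n -> s n = t n.
Proof.
have le s' t' : numbering s' X -> numbering t' X ->
    forall n, 0 < n -> s' n <= t' n.
  move=> sX tX n n0.
  by rewrite -ltnS (numbering_lt sX) // -(numbering_lt tX).
by move=> sX tX n n0; apply/eqP; rewrite eqn_leq (le _ _ sX tX) // (le _ _ tX sX).
Qed.

Lemma numbering_eq s t (X : multiset) : (forall n, 0 < n -> s n = t n) ->
  numbering s X -> numbering t X.
Proof.
move=> st [s_nd sX]; split=> [m n m0 mn|v].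
  by rewrite -!st ?s_nd //; lia.
rewrite /appears (_ : [set n | _] = [set n | 0 < n /\ s n = v]); first exact: sX.
by apply/seteqP; split=> n /= [n0 <-]; rewrite st.
Qed.

Lemma skippingE k d v :
  skipping k d v = `[< elements d v >] + k.-1.
Proof.
rewrite /skipping /sortjoin; congr addn; elim: k.-1 => //= j IH.
by rewrite /sortjoin IH /nonneg_ints /set_multiset asboolT.
Qed.

(** As [k > 0], no value appears both [k] and [k - 1] times, so its multiplicity decides membership
    in the set. *)
Lemma skipping_ruleP k d c : 0 < k ->
  skipping_rule k (elements d) c <-> numbering c (skipping k d).
Proof.
move=> k0; split=> -[c_nd cP]; split=> // v.
  rewrite skippingE; case: (cP v) => -[ck|ck] ckE.
    by rewrite asboolT ?add1n ?prednK //; apply/ckE.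
  rewrite asboolF // => /ckE ck'.
  have /card_eq_II : (`I_k #= `I_k.-1)%card.
    by apply: card_eq_trans ck; apply: card_esym.
  by lia.
have := cP v; rewrite skippingE; case: (pselect (elements d v)) => dv.
  by rewrite asboolT // add1n prednK // => ck; split; [left|].
rewrite asboolF // => ck; split; [by right|split=> // ck'].
have /card_eq_II : (`I_k #= `I_k.-1)%card.
  by apply: card_eq_trans ck; apply: card_esym.
by lia.
Qed.

(** Converse of [numbering_lt], with the cumulative multiplicity [S] given in closed form: [v] is
    taken at the indices [n] with [S v < n <= S v.+1]. *)
Lemma numbering_counting s (X : multiset) (S : nat -> nat) :
  (forall v, S v.+1 = S v + X v) -> S 0 = 0 ->
  (forall n v, 0 < n -> (s n < v) = (n <= S v)) -> numbering s X.
Proof.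
move=> SS S0 sS; split=> [m n m0 mn|v].
  have n0 : 0 < n by lia.
  by rewrite -ltnS sS // (leq_trans mn) // -sS.
rewrite /appears (_ : [set n | _] = [set n | S v < n <= S v + X v]).
  exact: card_interval.
apply/seteqP; split=> n /=.
  by move=> [n0 sn]; rewrite -SS -sS // sn ltnSn ltnNge -sS // sn ltnn.
move=> n_in; have n0 : 0 < n by lia.
by move: n_in; rewrite -SS -sS // ltnNge -sS //; lia.
Qed.

End NumberingTheory.

(** * Beatty sequences *)

Section Beatty.
Variable R : realType.
Implicit Types (al be x : R) (a b d s : nat -> nat).
Local Open Scope ring_scope.

Lemma beatty_leq be s n m : is_beatty be s -> (0 < n)%N ->
  (m <= s n)%N = (m%:R <= n%:R * be).
Proof. by move=> [_ sE] n0; rewrite -lez_nat sE // floor_ge_int. Qed.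

Lemma beatty_ltn be s n m : is_beatty be s -> (0 < n)%N ->
  (s n < m)%N = (n%:R * be < m%:R).
Proof. by move=> sb n0; rewrite ltnNge (beatty_leq _ sb n0) ltNge. Qed.

Lemma is_beattyI be s : 0 < be ->
  (forall n m, (0 < n)%N -> (m <= s n)%N = (m%:R <= n%:R * be)) ->
  is_beatty be s.
Proof.
move=> be0 sP; split=> // n n0; apply/esym/floor_def.
have -> : ((s n)%:Z + 1)%:~R = (s n).+1%:R :> R by rewrite -natr1 intrD.
by rewrite -[_%:~R]/((s n)%:R) -sP // leqnn /= ltNge -sP // ltnn.
Qed.

Lemma beatty_exists be : 0 < be -> exists s, is_beatty be s.
Proof.
move=> be0; exists (fun n => `|Num.floor (n%:R * be)|%N); split=> // n n0.
by rewrite gez0_abs // floor_ge0 mulr_ge0 // ltW.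
Qed.

Lemma beatty_increasing be s : 1 <= be -> is_beatty be s -> seq_increasing s.
Proof.
move=> be1 sb; apply: increasing_step => n n0.
have := beatty_leq (s n) sb n0; rewrite leqnn => /esym le_n.
by rewrite (beatty_leq _ sb) // -!natr1 mulrDl mul1r lerD.
Qed.

Lemma beatty_pos be s n : 1 <= be -> is_beatty be s -> (0 < n)%N -> (0 < s n)%N.
Proof.
move=> be1 sb n0; rewrite (beatty_leq _ sb) //.
by have : 1 <= n%:R :> R; [rewrite ler1n|nra].
Qed.

Lemma beatty_rank be s N : 1 <= be -> is_beatty be s ->
  (rank s N)%:R * be < N.+1%:R <= (rank s N).+1%:R * be.
Proof.
move=> be1 sb; have s_inc := beatty_increasing be1 sb.
have s_pos n := @beatty_pos be s n be1 sb.
apply/andP; split; last first.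
  by rewrite -(beatty_leq _ sb) // ltnNge -rank_ge // ltnn.
case: (posnP (rank s N)) => [->|p0]; first by rewrite mul0r ltr0n.
by rewrite -(beatty_ltn _ sb) // ltnS -rank_ge.
Qed.

(** A missing [N] leaves the rank as it was at [N - 1], which sharpens the bound of [beatty_rank] by
    one. *)
Lemma beatty_rank_notin be s N : 1 <= be -> is_beatty be s ->
  (0 < N)%N -> ~ elements s N -> (rank s N)%:R * be < N%:R.
Proof.
move=> be1 sb N0 sN.
have -> : rank s N = rank s N.-1.
  case: N N0 sN => // N _ sN.
  by rewrite /rank uptoS asboolF // addn0.
by have /andP[+ _] := beatty_rank N.-1 be1 sb; rewrite prednK.
Qed.

(** For positive [al] this is irrationality, in the form that excludes ties between its multiples
    and integers. *)
Definition irrational_slope al : Prop :=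
  forall n m : nat, (0 < n)%N -> n%:R * al <> m%:R.

(* As 1/al + 1/be = 1, adding i <= z/al and j <= z/be gives i + j <= z, strictly
   if one bound is strict. If i al and j be were both in [m, m+1), this would put
   i + j strictly between m and m+1; if m is missed, it puts the total number of
   terms below m strictly between m-1 and m. *)
Lemma rayleigh al be a b : 1 < al -> 1 < be -> al * be = al + be ->
  irrational_slope al -> is_beatty al a -> is_beatty be b ->
  complementary_seqs a b.
Proof.
move=> al1 be1 albe irr sa sb.
have [al0 be0] : 0 < al /\ 0 < be by split; lra.
have sum_lt (x y z : R) : x * al < z -> y * be <= z -> x + y < z.
  move=> xz yz; rewrite -(ltr_pM2r (_ : 0 < al * be)) ?mulr_gt0 //.
  have : x * al * be < z * be by rewrite ltr_pM2r.
  have : y * be * al <= z * al by rewrite ler_pM2r.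
  suff : z * (al * be) = z * (al + be) by lra.
  by rewrite albe.
have lt_sum (x y z : R) : z < x * al -> z <= y * be -> z < x + y.
  move=> xz yz; rewrite -(ltr_pM2r (_ : 0 < al * be)) ?mulr_gt0 //.
  have : z * be < x * al * be by rewrite ltr_pM2r.
  have : z * al <= y * be * al by rewrite ler_pM2r.
  suff : z * (al * be) = z * (al + be) by lra.
  by rewrite albe.
split; [by apply: beatty_increasing sa; lra|by apply: beatty_increasing sb; lra|].
split; apply/seteqP; split=> m //=.
- case=> -[i] /= i0 ai [j] /= j0 bj.
  have i_lt : m%:R < i%:R * al.
    by rewrite lt_neqAle -(beatty_leq _ sa) // ai leqnn andbT eq_sym; apply/eqP/irr.
  have j_le : m%:R <= j%:R * be by rewrite -(beatty_leq _ sb) // bj.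
  have i_gt : i%:R * al < m.+1%:R by rewrite -(beatty_ltn _ sa) // ai.
  have j_gt : j%:R * be <= m.+1%:R by rewrite ltW // -(beatty_ltn _ sb) // bj.
  have := lt_sum _ _ _ i_lt j_le; have := sum_lt _ _ _ i_gt j_gt.
  by rewrite -natrD !ltr_nat; lia.
- by case=> -[n /= n0 <-];
    [apply: beatty_pos sa n0|apply: beatty_pos sb n0]; lra.
- move=> m0; have [am|am] := pselect (elements a m); first by left.
  right; apply: contrapT => bm.
  have [al1' be1'] : 1 <= al /\ 1 <= be by split; lra.
  have := sum_lt _ _ _ (beatty_rank_notin al1' sa m0 am)
    (ltW (beatty_rank_notin be1' sb m0 bm)).
  have /andP[_ a_ge] := beatty_rank m al1' sa.
  have /andP[_ b_ge] := beatty_rank m be1' sb.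
  have a_gt : m.+1%:R < (rank a m).+1%:R * al.
    by rewrite lt_neqAle a_ge andbT eq_sym; apply/eqP/irr.
  have := lt_sum _ _ _ a_gt b_ge.
  by rewrite -!natrD !ltr_nat; lia.
Qed.

Lemma archi_eq0 (x y : R) : (forall N : nat, N%:R * `|x| <= y) -> x = 0.
Proof.
move=> xy; apply/eqP; apply: contraT => x0.
have nx : 0 < `|x| by rewrite normr_gt0.
have y0 : 0 <= y by have := xy 0%N; rewrite mul0r.
have := archi_boundP (divr_ge0 y0 (ltW nx)).
by rewrite ltr_pdivrMr // ltNge xy.
Qed.

(** The ranks up to [N] are [(N + 1) / al] and [(N + 1) / be] with errors at most 1, and they add up
    to [N]. Hence [(N + 1) * |al * be - (al + be)|] is at most [al * be] for every [N]. *)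
Lemma complementary_slope al be a b : complementary_seqs a b ->
  is_beatty al a -> is_beatty be b -> 1 <= al -> 1 <= be ->
  al * be = al + be.
Proof.
move=> comp sa sb al1 be1; apply/eqP; rewrite -subr_eq0; apply/eqP.
have [al0 be0] : 0 < al /\ 0 < be by split; lra.
apply: (@archi_eq0 _ (al * be)) => -[|N]; first by rewrite mul0r mulr_ge0 // ltW.
have /andP[a_lt a_ge] := beatty_rank N al1 sa.
have /andP[b_lt b_ge] := beatty_rank N be1 sb.
have NE : (rank a N)%:R + (rank b N)%:R = N.+1%:R - 1 :> R.
  by rewrite -natrD (compl_rank comp) -natr1; lra.
move: a_lt a_ge b_lt b_ge.
rewrite -[(rank a N).+1%:R]natr1 -[(rank b N).+1%:R]natr1.
move: NE; set p := (rank a N)%:R; set q := (rank b N)%:R; set M := N.+1%:R.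
move=> NE a_lt a_ge b_lt b_ge.
have : p * al * be < M * be by rewrite ltr_pM2r.
have : q * be * al < M * al by rewrite ltr_pM2r.
have : M * be <= (p + 1) * al * be by rewrite ler_pM2r.
have : M * al <= (q + 1) * be * al by rewrite ler_pM2r.
have : (p + q) * (al * be) = (M - 1) * (al * be) by rewrite NE.
have M0 : 0 <= M by rewrite ler0n.
rewrite -[X in X * `|_|](ger0_norm M0) -normrM ler_norml.
clearbody p q M; move=> *; apply/andP; split; lra.
Qed.

Lemma slope_ge1 be s : (forall n, (0 < n)%N -> (0 < s n)%N) ->
  is_beatty be s -> 1 <= be.
Proof.
by move=> s_pos sb; have := s_pos 1%N isT; rewrite (beatty_leq _ sb) // mul1r.
Qed.

Section ComplementaryBeatty.
Variables (a b : nat -> nat) (al be : R).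
Hypotheses (comp : complementary_seqs a b) (sa : is_beatty al a)
  (sb : is_beatty be b) (al12 : 1 < al < 2).

Let al_gt1 : 1 < al. Proof. by case/andP: al12. Qed.
Let al_lt2 : al < 2. Proof. by case/andP: al12. Qed.

Let slopeE : al * be = al + be.
Proof.
have [_ b_pos] := compl_pos comp.
apply: complementary_slope comp sa sb (ltW al_gt1) _.
exact: slope_ge1 b_pos sb.
Qed.

(* If n al = m were an integer, then (m - n) be = m as well, and m would be a
   term of both sequences. *)
Lemma complementary_beatty_irrational : irrational_slope al.
Proof.
move=> n m n0 nm; have am : a n = m.
  apply/eqP; rewrite eqn_leq (beatty_leq _ sa) // -nm lexx andbT.
  by rewrite -ltnS (beatty_ltn _ sa) // nm ltr_nat.
have nm_lt : (n < m)%N.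
  by rewrite -(ltr_nat R) -nm ltr_pMr ?ltr0n //; lra.
have mn0 : (0 < m - n)%N by rewrite subn_gt0.
have mE : (m - n)%:R * be = m%:R.
  rewrite natrB ?(ltnW nm_lt) // -nm.
  suff : n%:R * (al * be) = n%:R * (al + be) by lra.
  by rewrite slopeE.
apply: (compl_neq comp n0 mn0); rewrite am.
apply/eqP; rewrite eqn_leq (beatty_leq _ sb) // mE lexx /=.
by rewrite -ltnS (beatty_ltn _ sb) // mE ltr_nat.
Qed.

(** Since [al < 2], the relation between the slopes gives [al < be], hence [a n <= b n];
    disjointness makes it strict. *)
Lemma complementary_beatty_ltn n : (0 < n)%N -> (a n < b n)%N.
Proof.
move=> n0; rewrite (ltn_neqAle (a n)); apply/andP; split.
  by apply/eqP/(compl_neq comp).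
rewrite (beatty_leq _ sb) //; apply: le_trans (_ : n%:R * al <= _).
  by rewrite -(beatty_leq _ sa).
by rewrite ler_pM2l ?ltr0n //; have := slopeE; have := al_gt1; have := al_lt2; nra.
Qed.

(** The slope is [be - 2] by the relation between [al] and [be], and the count is [b n - 2n]. *)
Lemma beatty_countC : is_beatty ((2 - al) / (al - 1)) (countC a b).
Proof.
have al1 : 0 < al - 1 by rewrite subr_gt0.
have albe := slopeE; have al2 := al_lt2.
have -> : (2 - al) / (al - 1) = be - 2.
  by apply: (mulIf (lt0r_neq0 al1)); rewrite divfK ?lt0r_neq0 //; lra.
apply: is_beattyI => [|n m n0]; first by nra.
have E := countC_term comp n0 (complementary_beatty_ltn n0).
rewrite -(leq_add2r n.*2) E (beatty_leq _ sb) // -mul2n natrD natrM.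
by apply/idP/idP; lra.
Qed.

(** The count is [2n - 1 - a n]. Reflecting a floor exchanges strict and weak inequalities;
    irrationality removes the case of equality. *)
Lemma beatty_countR : is_beatty (2 - al) (countR a b).
Proof.
apply: is_beattyI => [|n m n0]; first by rewrite subr_gt0.
have E := countR_term comp n0 (complementary_beatty_ltn n0).
have irr := complementary_beatty_irrational.
(* For [m >= 2n] the subtraction [n.*2 - m] would truncate; there both sides are false. *)
case: (leqP n.*2 m) => nm.
  have -> : (m <= countR a b n)%N = false.
    by have := (compl_pos comp).1 n n0; lia.
  apply/esym/negbTE; rewrite -ltNge.
  have : n.*2%:R <= m%:R :> R by rewrite ler_nat.
  have : 0 < n%:R :> R by rewrite ltr0n.
  by rewrite -mul2n natrM; have := al_gt1; nra.
have -> : (m <= countR a b n)%N = (a n < n.*2 - m)%N by lia.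
have nal : n%:R * al != (n.*2 - m)%:R by apply/eqP/irr.
rewrite (beatty_ltn _ sa) // (lt_neqAle (n%:R * al)) nal /=.
by rewrite natrB ?(ltnW nm) // -mul2n natrM; apply/idP/idP; lra.
Qed.

End ComplementaryBeatty.

End Beatty.

(** * The slopes [alpha R k] *)

Lemma succ_sqr_nonsquare (k n p : nat) :
  0 < k -> 0 < n -> n ^ 2 * (k ^ 2 + 1) <> p ^ 2.
Proof.
move=> k0 n0 E; have : n ^ 2 %| p ^ 2 by rewrite -E dvdn_mulr.
rewrite dvdn_pexp2r // => /dvdnP[q pE]; move/eqP: E.
rewrite pE mulnC expnMn eqn_pmul2r ?expn_gt0 ?n0 // => /eqP E.
(* Here [q ^ 2 = k ^ 2 + 1] would lie strictly between two consecutive squares. *)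
by case: (leqP q k) => qk; nia.
Qed.

Lemma complementary_seqs_eq a a' b : (forall n, 0 < n -> a n = a' n) ->
  complementary_seqs a b -> complementary_seqs a' b.
Proof.
move=> aa' [a_inc b_inc comp]; split=> // [m n m0 mn|].
  by rewrite -!aa' ?a_inc //; lia.
rewrite (_ : elements a' = elements a) //; apply/seteqP.
by split=> m [k /= k0 <-]; exists k; rewrite ?aa'.
Qed.

(** The ranks of a complement are forced by those of [a], and an increasing sequence is determined
    by its ranks. *)
Lemma complementary_unique a b b' :
  complementary_seqs a b -> complementary_seqs a b' ->
  forall n, 0 < n -> b n = b' n.
Proof.
suff le b1 b2 : complementary_seqs a b1 -> complementary_seqs a b2 ->
    forall n, 0 < n -> b1 n <= b2 n.
  move=> comp comp' n n0; apply/eqP.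
  by rewrite eqn_leq (le _ _ comp comp') // (le _ _ comp' comp).
move=> comp1 comp2 n n0; have [_ b1_inc _] := comp1; have [_ b2_inc _] := comp2.
have [_ b1_pos] := compl_pos comp1; have [_ b2_pos] := compl_pos comp2.
have rankE N : rank b1 N = rank b2 N.
  by have := compl_rank comp1 N; have := compl_rank comp2 N; lia.
by rewrite -(rank_ge b1_inc) // rankE rank_term.
Qed.

Lemma MES_eq c c' a b r : (forall n, 0 < n -> c n = c' n) ->
  MES c a b r -> MES c' a b r.
Proof. by move=> cc' [a1 aE bE rE]; split=> // n n0; rewrite -cc' ?bE. Qed.

Section Alpha.
Variables (R : realType) (k : nat).
Hypothesis k_gt0 : 0 < k.
Local Open Scope ring_scope.

Let al : R := alpha R k.
Let s : R := Num.sqrt (k%:R ^+ 2 + 1).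

Let k_ge1 : 1 <= k%:R :> R. Proof. by rewrite ler1n. Qed.

Let sqr_s : s * s = k%:R * k%:R + 1.
Proof. by rewrite -expr2 sqr_sqrtr ?expr2 // addr_ge0 // mulr_ge0. Qed.

Let s_ge0 : 0 <= s. Proof. exact: sqrtr_ge0. Qed.

Let alphaE : k%:R * al = k%:R - 1 + s.
Proof. by rewrite mulrC divfK // pnatr_eq0 -lt0n. Qed.

Lemma alpha_bounds : 1 < al < 2.
Proof.
have k1 := k_ge1; have s0 := s_ge0; have ss := sqr_s; have E := alphaE.
have s1 : 1 < s by nra.
have sk : s < k%:R + 1 by nra.
by apply/andP; split; nra.
Qed.

Let al_gt1 : 1 < al. Proof. by case/andP: alpha_bounds. Qed.
Let al_lt2 : al < 2. Proof. by case/andP: alpha_bounds. Qed.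

Lemma alpha_quadratic : k%:R * al * al = 2 * (k%:R - 1) * al + 2.
Proof.
have k1 := k_ge1; have ss := sqr_s; have E := alphaE.
have k0 : k%:R != 0 :> R by rewrite pnatr_eq0 -lt0n.
apply: (mulfI k0).
have -> : k%:R * (k%:R * al * al) = (k%:R * al) * (k%:R * al) by ring.
have -> : k%:R * (2 * (k%:R - 1) * al + 2) =
  2 * (k%:R - 1) * (k%:R * al) + 2 * k%:R by ring.
by rewrite !E; nra.
Qed.

(** From [n * al = m] follows [n * s = k * m - n * (k - 1)], which makes [n ^ 2 * (k ^ 2 + 1)] a
    square. *)
Lemma alpha_irrational : irrational_slope al.
Proof.
move=> n m n0 nm.
have E : n%:R * s = (k * m)%:R - (n * k.-1)%:R.
  have -> : (n * k.-1)%:R = n%:R * (k%:R - 1) :> R.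
    by rewrite natrM -{2}(prednK k_gt0) -natr1 addrK.
  rewrite natrM -nm; have := alphaE => aE.
  have -> : k%:R * (n%:R * al) = n%:R * (k%:R * al) by ring.
  by rewrite aE; ring.
have le : (n * k.-1 <= k * m)%N.
  by rewrite -(ler_nat R) -subr_ge0 -E mulr_ge0 ?ler0n // s_ge0.
apply: (@succ_sqr_nonsquare k n (k * m - n * k.-1) k_gt0 n0).
apply/eqP; rewrite -(eqr_nat R) natrM !natrX natrD natrX natrB // -E.
have := sqr_s; rewrite !expr2 => <-; apply/eqP; ring.
Qed.

(* The terms of g below v are the first v(k-1) + #{m : d_m < v} ones. *)
Lemma alpha_gamma_numbering d g :
  is_beatty al d -> is_beatty ((2 - al) / (al - 1)) g ->
  numbering g (skipping k d).
Proof.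
move=> db gb; have d_inc := beatty_increasing (ltW al_gt1) db.
have d_pos n := @beatty_pos R al d n (ltW al_gt1) db.
have k1 := k_ge1; have q := alpha_quadratic; have a1 := al_gt1; have a2 := al_lt2.
have kE : k.-1%:R = k%:R - 1 :> R by rewrite -{2}(prednK k_gt0) -natr1 addrK.
apply: (@numbering_counting _ _ (fun v => v * k.-1 + rank d v.-1)%N) => //.
  (* The value 0 is apart: both truncated predecessors are 0, and 0 is not a term of [d]. *)
  case=> [|v]; rewrite skippingE.
    rewrite /= asboolF => [|[n /= n0 dn]].
      by rewrite mul1n mul0n !add0n addnC.
    by have := d_pos n n0; rewrite dn.
  by rewrite /= {1}/rank uptoS -/(rank d v) mulSn; lia.
move=> n [|v] n0; first by rewrite /rank /upto /= ltn0 leqNgt n0.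
rewrite (beatty_ltn _ gb) // mulrA ltr_pdivrMr ?subr_gt0 //.
set u := v.+1; have u0 : 0 < u%:R :> R by rewrite ltr0n.
(* This is 1/gamma = k - 1 + 1/alpha cleared of denominators. *)
have qE : (2 - al) * ((k%:R - 1) * al + 1) = al * (al - 1) by lra.
have factor : (u%:R * (al - 1) - n%:R * (2 - al)) * ((k%:R - 1) * al + 1) =
    (al - 1) * (u%:R * (k%:R - 1) * al + u%:R - n%:R * al).
  rewrite mulrBl -(mulrA n%:R) qE; ring.
have -> : (n%:R * (2 - al) < u%:R * (al - 1)) =
    (n%:R * al < u%:R * (k%:R - 1) * al + u%:R).
  rewrite -subr_gt0 -[RHS]subr_gt0.
  rewrite -[RHS](pmulr_rgt0 _ (_ : 0 < al - 1)) ?subr_gt0 //.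
  by rewrite -factor pmulr_lgt0 //; nra.
have ukE : (u * k.-1)%:R = u%:R * (k%:R - 1) :> R by rewrite natrM kE.
(* If [n <= u * (k - 1)] both sides hold; otherwise the excess [n - u * (k - 1)] is a positive index
   to which [rank_ge] applies. *)
case: (leqP n (u * k.-1)) => nu.
  have -> : (n <= u * k.-1 + rank d u.-1)%N by rewrite (leq_trans nu) ?leq_addr.
  have : n%:R <= u%:R * (k%:R - 1) :> R by rewrite -ukE ler_nat.
  rewrite -(ler_pM2r (lt_trans ltr01 al_gt1)) => nle; lra.
have m0 : (0 < n - u * k.-1)%N by rewrite subn_gt0.
have -> : (n <= u * k.-1 + rank d u.-1)%N = (n - u * k.-1 <= rank d u.-1)%N.
  by rewrite leq_subLR.
rewrite rank_ge // -ltnS (beatty_ltn _ db) // natrB ?(ltnW nu) // ukE.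
by rewrite -[u.-1.+1]/u; apply/idP/idP; lra.
Qed.

(** * MES on the skipping sequence of slope [alpha R k] *)

Section Generated.
Variable d : nat -> nat.
Hypothesis db : is_beatty al d.

(** The slope conjugate to [al]: the solution of [1/al + 1/be = 1]. *)
Let be : R := al / (al - 1).

Let slopeE : al * be = al + be.
Proof.
have a1 : al - 1 != 0 by rewrite lt0r_neq0 // subr_gt0.
have E : be * (al - 1) = al by rewrite divfK.
by lra.
Qed.

Let be_gt1 : 1 < be.
Proof.
rewrite ltr_pdivlMr ?subr_gt0 //; lra.
Qed.

(** Both [c] and the count for Rayleigh's complement number the same multiset, and a multiset has
    only one numbering. *)
Lemma alpha_complement :
  exists b, [/\ is_beatty be b, complementary_seqs d b &
    forall c, numbering c (skipping k d) ->
    forall n, (0 < n)%N -> c n = countC d b n].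
Proof.
have [b bb] := beatty_exists (lt_trans ltr01 be_gt1).
have comp := rayleigh al_gt1 be_gt1 slopeE alpha_irrational db bb.
exists b; split=> // c cn.
apply: numbering_unique cn _; apply: alpha_gamma_numbering db _.
exact: beatty_countC comp db bb alpha_bounds.
Qed.

(** MES run on [countC d b0] rebuilds [d] and its complement [b0]; since [c] agrees with that count,
    uniqueness of the output identifies the two runs. *)
Lemma alpha_MES c a b r : numbering c (skipping k d) -> MES c a b r ->
  [/\ forall n, (0 < n)%N -> a n = d n, complementary_seqs d b & is_beatty be b].
Proof.
have [b0 [b0b comp cE]] := alpha_complement.
move=> cn mes.
have mes0 := compl_MES comp (complementary_beatty_ltn comp db b0b alpha_bounds).
have E := MES_unique mes0 (MES_eq (cE _ cn) mes).
have aE n : (0 < n)%N -> a n = d n by move=> /E[].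
split=> //.
  apply: complementary_seqs_eq aE _.
  exact: MES_complementary_seqs mes (MES_b_increasing mes cn.1).
by case: b0b => be0 b0E; split=> // n n0; have [_ -> _] := E n n0; apply: b0E.
Qed.

(** Either alternative makes [b] increasing. If [a] is [d], then [b] must be the Rayleigh
    complement, and [c n = b n - 2n] is the known numbering. *)
Lemma alpha_MES_iff c a b r : MES c a b r ->
  seq_nondecreasing c \/ seq_increasing b ->
  (forall n, (0 < n)%N -> a n = d n) <-> skipping_rule k (elements d) c.
Proof.
move=> mes mono; rewrite skipping_ruleP //; split=> [aE|cn]; last first.
  by case: (alpha_MES cn mes).
have b_inc : seq_increasing b by case: mono => // /(MES_b_increasing mes).
have compa := MES_complementary_seqs mes b_inc.
have [b0 [b0b comp _]] := alpha_complement.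
have b0E := complementary_unique (complementary_seqs_eq aE compa) comp.
apply: numbering_eq (alpha_gamma_numbering db _);
  last exact: beatty_countC comp db b0b alpha_bounds.
move=> n n0; rewrite (MES_countC mes b_inc n0).
have ltab := MES_ltn mes n0.
have := countC_term compa n0 ltab; rewrite b0E //.
have := countC_term comp n0 (complementary_beatty_ltn comp db b0b alpha_bounds n0).
lia.
Qed.

End Generated.
End Alpha.

Lemma alpha2 (R : realType) : alpha R 2 = golden R.
Proof.
rewrite /alpha /golden; congr (_ / _)%R; congr (_ + _)%R; first by lra.
by congr Num.sqrt; ring.
Qed.

(** For [k = 2] the quadratic relation reads [al ^ 2 = al + 1], so the conjugate slope is [al + 1]
    and the two floors differ by exactly [n]. *)
Lemma golden_MEX (R : realType) d c a b r : is_beatty (alpha R 2) d ->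
  numbering c (skipping 2 d) -> MES c a b r -> MEX id a b.
Proof.
move=> db cn mes; have [ad comp bb] := alpha_MES (isT : 0 < 2) db cn mes.
case: mes => a1 aE _ _; split=> // n n0; rewrite ad //=.
have := alpha_quadratic R (isT : 0 < 2); set al := alpha R 2 in bb db * => q.
have al1 : (0 < al - 1)%R.
  by have /andP[] := alpha_bounds R (isT : 0 < 2); rewrite subr_gt0.
have beE : (al / (al - 1) = al + 1)%R.
  by apply: (mulIf (lt0r_neq0 al1)); rewrite divfK ?lt0r_neq0 //; lra.
rewrite beE in bb; apply/eqP; rewrite eqn_leq; apply/andP; split.
  case: (leqP n (b n)) => nb; last by rewrite (leq_trans (ltnW nb)) ?leq_addl.
  rewrite addnC -leq_subLR (beatty_leq _ db) // natrB //.
  by have := beatty_leq (b n) bb n0; rewrite leqnn => /esym; lra.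
rewrite (beatty_leq _ bb) // natrD.
by have := beatty_leq (d n) db n0; rewrite leqnn => /esym; lra.
Qed.

Theorem theorem4p1 (R : realType) :
  [/\ (* (1) *)
      forall a b : nat -> nat, complementary_seqs a b ->
      forall n, 0 < n ->
        `|(b n)%:Z - (a n)%:Z|%R = (countC a b n + countR a b n + 1)%:Z%R /\
        (a n < b n ->
         ((b n)%:Z - (a n)%:Z)%R = (countC a b n + countR a b n + 1)%:Z%R),
      (* (2) *)
      forall (a b : nat -> nat) (al be : R), complementary_seqs a b ->
        is_beatty al a -> is_beatty be b -> (1 < al < 2)%R ->
        is_beatty ((2 - al) / (al - 1))%R (countC a b) /\
        is_beatty (2 - al)%R (countR a b),
      (* (3) *)
      [/\ forall c : nat -> nat, exists a b r : nat -> nat,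
            MES c a b r /\
            forall a' b' r' : nat -> nat, MES c a' b' r' ->
            forall n, 0 < n -> [/\ a' n = a n, b' n = b n & r' n = r n],
          forall c a b r : nat -> nat, MES c a b r -> seq_increasing b ->
          forall n, 0 < n ->
            [/\ ((b n)%:Z - (a n)%:Z)%R = (c n + r n + 1)%:Z%R,
                c n = countC a b n & r n = countR a b n],
          forall c a b r : nat -> nat, MES c a b r ->
            seq_increasing a /\ complementary (elements a) (elements b)
        & forall a b : nat -> nat,
            (complementary_seqs a b /\ forall n, 0 < n -> a n < b n) <->
            (seq_increasing b /\ exists c r : nat -> nat, MES c a b r)]
    & (* (4) *)
      forall (k : nat) (d : nat -> nat), 0 < k ->
        seq_increasing d -> (forall n, 0 < n -> 0 < d n) ->
        (* (a) *)
        (k = 2 -> is_beatty (golden R) d ->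
           (forall c a b r : nat -> nat,
              numbering c (skipping k d) -> MES c a b r ->
              [/\ MEX id a b, is_beatty (golden R) a
                & forall n, 0 < n -> a n = d n]) /\
           (forall c a b r : nat -> nat,
              MES c a b r -> (seq_nondecreasing c \/ seq_increasing b) ->
              ((forall n, 0 < n -> a n = d n) <->
               skipping_rule 2 (elements d) c)))
        /\
        (* (b) *)
        (is_beatty (alpha R k) d ->
           [/\ forall c a b r : nat -> nat,
                 numbering c (skipping k d) -> MES c a b r ->
                 (forall n, 0 < n -> a n = d n) /\ complementary_seqs d b,
               forall c a b r : nat -> nat,
                 MES c a b r -> (seq_nondecreasing c \/ seq_increasing b) ->
                 ((forall n, 0 < n -> a n = d n) <->
                  skipping_rule k (elements d) c)
             & k = 2 ->
                 alpha R k = golden R /\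
                 forall c a b r : nat -> nat,
                   numbering c (skipping k d) -> MES c a b r -> MEX id a b])].

Proof.
split.
- move=> a b comp n n0; have E := countCR comp n0; split=> // ab.
  by rewrite -E ger0_norm // subr_ge0 lez_nat ltnW.
- move=> a b al be comp sa sb al12; split.
    exact: beatty_countC comp sa sb al12.
  exact: beatty_countR comp sa sb al12.
- split.
  + move=> c; have [a [b [r mes]]] := MES_exists c.
    by exists a, b, r; split=> // a' b' r'; apply: MES_unique.
  + move=> c a b r mes b_inc n n0.
    have comp := MES_complementary_seqs mes b_inc; have ab := MES_ltn mes n0.
    rewrite (MES_countC mes b_inc n0) (MES_countR mes b_inc n0); split=> //.
    by rewrite -(countCR comp n0) ger0_norm // subr_ge0 lez_nat ltnW.
  + move=> c a b r mes.
    by split; [exact: MES_a_increasing mes|exact: MES_complementary mes].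
  + move=> a b; split=> [[comp ab]|[b_inc [c [r mes]]]].
      split; first by case: comp.
      by exists (countC a b), (countR a b); apply: compl_MES.
    by split; [exact: MES_complementary_seqs mes b_inc|exact: MES_ltn mes].
- move=> k d k0 _ _; split=> [k2|db].
    subst k; rewrite -alpha2 => db; split=> [c a b r cn mes|c a b r mes mono].
      have [ad _ _] := alpha_MES (isT : 0 < 2) db cn mes.
      split=> //; first exact: golden_MEX db cn mes.
      by case: db => al0 dE; split=> // n n0; rewrite ad ?dE.
    exact: (alpha_MES_iff k0 db mes mono).
  split=> [c a b r cn mes|c a b r mes mono|k2].
  + by have [] := alpha_MES k0 db cn mes.
  + exact: (alpha_MES_iff k0 db mes mono).
  + subst k; split; first exact: alpha2.
    by move=> c a b r cn mes; apply: golden_MEX db cn mes.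
Qed.
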